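(* Let $\theta\in[\tfrac12,1]$, $\epsilon>0$, $\beta>0$, $\lambda_1,\lambda_2>0$. Let $(\phi^n)$ (functions on $\Omega$) and $(u^n)$ (real numbers) be a solution of the $\mathcal V_L$-method on the (possibly nonuniform) mesh $0=t_0<\dots<t_N=T$, i.e. for every $1\le n\le N-1$, $$\tilde D_\tau^{\theta}\phi^{n+\theta}=\nabla\cdot\big(M^{*,n+\theta}\nabla\mu^{n+\theta}\big),$$ $$\mu^{n+\theta}=\frac{u^{n+1}}{\sqrt{\widetilde E_1^{n}}}V(\xi^{n+1})\mathcal H^{*,n+\theta}+\beta\Delta^2\phi^{n+\theta}+\frac{\lambda_1}{\epsilon^2}\phi^{n+\theta}-\lambda_2\Delta\phi^{n+\theta},$$ $$\frac{u^{n+1}-u^n}{\tau_{n+1}}=\frac{V(\xi^{n+1})}{2\sqrt{\widetilde E_1^{n}}}\int_\Omega\mathcal H^{*,n+\theta}\,\frac{\phi^{n+1}-\phi^n}{\tau_{n+1}}\,d\Omega,\qquad \xi^{n+1}=\frac{u^{n+1}}{\sqrt{\widetilde E_1^{n}}},$$ with starting values satisfying $\int_\Omega\phi^1d\Omega=\int_\Omega\phi^0d\Omega$. Then the scheme conserves mass: $$\int_\Omega\phi^{n+1}d\Omega=\int_\Omega\phi^{n}d\Omega=\cdots=\int_\Omega\phi^{0}d\Omega\qquad\text{for all } 0\le n\le N-1.$$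
   Context: $\Omega\subset\mathbb R^d$ ($d=2,3$) is a bounded domain; all functions satisfy periodic boundary conditions (so integration by parts produces no boundary terms) and are sufficiently regular that all expressions below are well defined. Time mesh: $0=t_0<t_1<\cdots<t_N=T$, $\tau_n=t_n-t_{n-1}$, $\gamma_{n+1}=\tau_{n+1}/\tau_n$. For a sequence $(w^n)$, $$\tilde D_\tau^\theta w^{n+\theta}=\frac{1+2\theta\gamma_{n+1}}{\tau_{n+1}(1+\gamma_{n+1})}(w^{n+1}-w^n)+\frac{(1-2\theta)\gamma_{n+1}^2}{\tau_{n+1}(1+\gamma_{n+1})}(w^n-w^{n-1}),$$ $\phi^{n+\theta}=\theta\phi^{n+1}+(1-\theta)\phi^n$, $\phi^{*,n+\theta}=(1+\theta\gamma_{n+1})\phi^n-\theta\gamma_{n+1}\phi^{n-1}$. Anisotropic quantities: $\mathbf n=\nabla\phi/|\nabla\phi|$, $\gamma(\mathbf n)=1+\alpha\big(4\sum_{i=1}^d n_i^4-3\big)$ with $\alpha\ge0$ (not to be confused with the step ratios $\gamma_n$), $F(\phi)=\frac14(\phi^2-1)^2$, $f=F'$, $$\mathbf m=\gamma(\mathbf n)\nabla\phi+\frac{\mathbb P\nabla_{\mathbf n}\gamma(\mathbf n)}{|\nabla\phi|}\Big(\tfrac12|\nabla\phi|^2+\tfrac1{\epsilon^2}F(\phi)\Big),\qquad \mathbb P=\mathbb I-\mathbf n\mathbf n^T,$$ $$\mathcal H(\phi)=\frac1{\epsilon^2}\gamma(\mathbf n)f(\phi)-\nabla\cdot\mathbf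 m-\frac{\lambda_1}{\epsilon^2}\phi+\lambda_2\Delta\phi,\qquad \mathcal H^{*,n+\theta}=\mathcal H(\phi^{*,n+\theta}),$$ $$\widetilde E_1(\phi)=\int_\Omega\Big(\gamma(\mathbf n)\big(\tfrac12|\nabla\phi|^2+\tfrac1{\epsilon^2}F(\phi)\big)-\frac{\lambda_1}{2\epsilon^2}|\phi|^2-\frac{\lambda_2}2|\nabla\phi|^2\Big)d\Omega+C_0,\qquad \widetilde E_1^n=\widetilde E_1(\phi^n),$$ where the constant $C_0>0$ is chosen so that $\widetilde E_1>0$. The mobility $M(\phi)\ge M_0>0$ is a function of $\phi$ or a constant, and $M^{*,n+\theta}=M(\phi^{*,n+\theta})$. $V\in C^2(\mathbb R)$ is a positive real function with $V(1)=1$ and $\lim_{\xi\to1}\frac{V(\xi)-1}{1-\xi}=1$. *)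

(* Defs.v *)
From HB Require Import structures.
From mathcomp Require Import all_boot all_order all_algebra.
From mathcomp Require Import all_classical all_reals all_analysis.
Set Implicit Arguments.
Unset Strict Implicit.
Unset Printing Implicit Defensive.
Import Order.TTheory GRing.Theory Num.Theory.
Import numFieldNormedType.Exports.
Local Open Scope classical_set_scope.
Local Open Scope ring_scope.

(* Points of the space are row vectors.  The library norm `|x| on 'rV[R]_d is
   the sup norm, so the Euclidean norm is defined separately. *)

Section calculus.
Variables (R : realType) (d : nat).
Implicit Types (f : 'rV[R]_d -> R) (w : 'rV[R]_d -> 'rV[R]_d).

Definition enorm (v : 'rV[R]_d) : R := Num.sqrt (\sum_i v 0 i ^+ 2).

Definition partial (i : 'I_d) f : 'rV[R]_d -> R :=
  fun x => 'D_(delta_mx 0 i) f x.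

Definition grad f : 'rV[R]_d -> 'rV[R]_d := fun x => \row_i partial i f x.

Definition divergence w : 'rV[R]_d -> R :=
  fun x => \sum_i partial i (fun y => w y 0 i) x.

Definition laplacian f : 'rV[R]_d -> R := divergence (grad f).

Fixpoint classC (k : nat) f : Prop :=
  match k with
  | 0 => continuous f
  | k'.+1 => [/\ continuous f,
      forall i x, derivable f x (delta_mx 0 i) &
      forall i, classC k' (partial i f)]
  end.

(* The periodic cell is the box with opposite corners a and b; functions on it
   with periodic boundary conditions are functions on the whole space with
   period b_i - a_i in the i-th direction. *)
Definition cell (a b : 'rV[R]_d) : set 'rV[R]_d :=
  [set x | forall i, a 0 i < x 0 i < b 0 i].

Definition cell_periodic (a b : 'rV[R]_d) f : Prop :=
  forall i x, f (x + (b 0 i - a 0 i) *: delta_mx 0 i) = f x.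

(* Lebesgue integral over Omega for d = 2, 3.  The library has the product
   Lebesgue measures on R * R and R * R * R, from which they are transported
   to 'rV[R]_d.  For the other values of d it is a dummy 0. *)
Definition vec2 (p : R * R) : 'rV[R]_d := \row_i [:: p.1; p.2]`_i.

Definition vec3 (p : R * R * R) : 'rV[R]_d :=
  \row_i [:: p.1.1; p.1.2; p.2]`_i.

Definition integral_on (Omega : set 'rV[R]_d) f : R :=
  let leb := @lebesgue_measure R in
  if d == 2%N then \int[(leb \x leb)%E]_(p in vec2 @^-1` Omega) f (vec2 p)
  else if d == 3%N then
    \int[((leb \x leb) \x leb)%E]_(p in vec3 @^-1` Omega) f (vec3 p)
  else 0.

End calculus.

Definition classC_real (R : realType) (k : nat) (g : R -> R) : Prop :=
  (forall j (x : R), (j < k)%N -> derivable (derive1n j g) x 1) /\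
  continuous (derive1n k g).

Section anisotropic_energy.
Variables (R : realType) (d : nat).
Implicit Types phi : 'rV[R]_d -> R.

(* Division by |grad phi| = 0 yields 0 here, so normal phi vanishes at the
   critical points of phi, where it is mathematically undefined. *)
Definition normal phi : 'rV[R]_d -> 'rV[R]_d :=
  fun x => (enorm (grad phi x))^-1 *: grad phi x.

Definition aniso (alpha : R) (v : 'rV[R]_d) : R :=
  1 + alpha * (4 * (\sum_i v 0 i ^+ 4) - 3).

Definition dwell (s : R) : R := 1 / 4 * (s ^+ 2 - 1) ^+ 2.

(* The vector v *m tangent_proj n is the transpose of P v^T, because the
   projection P = I - n n^T is symmetric. *)
Definition tangent_proj (n : 'rV[R]_d) : 'M[R]_d := 1%:M - n^T *m n.

Definition energy_density (eps : R) phi : 'rV[R]_d -> R :=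
  fun x => 1 / 2 * enorm (grad phi x) ^+ 2 + 1 / eps ^+ 2 * dwell (phi x).

Definition mvec (alpha eps : R) phi : 'rV[R]_d -> 'rV[R]_d := fun x =>
  let n := normal phi x in
  aniso alpha n *: grad phi x
  + (energy_density eps phi x / enorm (grad phi x))
      *: (grad (aniso alpha) n *m tangent_proj n).

Definition calH (alpha eps lambda1 lambda2 : R) phi : 'rV[R]_d -> R := fun x =>
  1 / eps ^+ 2 * aniso alpha (normal phi x) * derive1 dwell (phi x)
  - divergence (mvec alpha eps phi) x
  - lambda1 / eps ^+ 2 * phi x
  + lambda2 * laplacian phi x.

(* H is the function calH phi.  If alpha <> 0 the formula is a genuine one only
   where the gradient of phi is nonzero (a periodic phi always has critical
   points), so the value of H at the critical points is left free: in a regular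
   solution it is the continuous extension, which need not be the value that
   the convention x / 0 = 0 gives.  If alpha = 0 the ill-defined terms have the
   factor 0 and the formula holds everywhere. *)
Definition is_calH (alpha eps lambda1 lambda2 : R) phi H : Prop :=
  forall x, alpha = 0 \/ grad phi x != 0 ->
    H x = calH alpha eps lambda1 lambda2 phi x.

Definition E1 (Omega : set 'rV[R]_d) (alpha eps lambda1 lambda2 C0 : R) phi
    : R :=
  integral_on Omega (fun x =>
    aniso alpha (normal phi x) * energy_density eps phi x
    - lambda1 / (2 * eps ^+ 2) * phi x ^+ 2
    - lambda2 / 2 * enorm (grad phi x) ^+ 2) + C0.

End anisotropic_energy.

Section time_discretization.
Variables (R : realType) (t : nat -> R).

Definition time_mesh (N : nat) (T : R) : Prop :=
  [/\ t 0%N = 0, t N = T & forall n, (n < N)%N -> t n < t n.+1].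

(* Both are meant for n >= 1, respectively n >= 2. *)
Definition tau (n : nat) : R := t n - t n.-1.
Definition step_ratio (n : nat) : R := tau n / tau n.-1.

Variables (X : Type) (theta : R) (w : nat -> X -> R).

(* The second argument n stands for the time level n + theta, n >= 1. *)
Definition Dtau (n : nat) : X -> R := fun x =>
  (1 + 2 * theta * step_ratio n.+1) / (tau n.+1 * (1 + step_ratio n.+1))
    * (w n.+1 x - w n x)
  + (1 - 2 * theta) * step_ratio n.+1 ^+ 2 / (tau n.+1 * (1 + step_ratio n.+1))
    * (w n x - w n.-1 x).

Definition at_theta (n : nat) : X -> R := fun x =>
  theta * w n.+1 x + (1 - theta) * w n x.

Definition extrapolated (n : nat) : X -> R := fun x =>
  (1 + theta * step_ratio n.+1) * w n x - theta * step_ratio n.+1 * w n.-1 x.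

End time_discretization.

(* One step n -> n.+1 of the scheme, n >= 1; mu and H stand for mu^{n+theta}
   and for calH at the extrapolated phi. *)
Section VL_step.
Variables (R : realType) (d : nat) (Omega : set 'rV[R]_d).
Variables (alpha eps beta lambda1 lambda2 C0 theta : R) (M V : R -> R).
Variables (t : nat -> R) (phi : nat -> 'rV[R]_d -> R) (u : nat -> R).

Definition sqrtE1 (n : nat) : R :=
  Num.sqrt (E1 Omega alpha eps lambda1 lambda2 C0 (phi n)).

Definition xi (n : nat) : R := u n.+1 / sqrtE1 n.

Definition VL_step (n : nat) (mu H : 'rV[R]_d -> R) : Prop :=
  [/\ is_calH alpha eps lambda1 lambda2 (extrapolated t theta phi n) H,
      forall x, Dtau t theta phi n x =
        divergence (fun y => M (extrapolated t theta phi n y) *: grad mu y) x,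
      forall x, mu x =
        u n.+1 / sqrtE1 n * V (xi n) * H x
        + beta * laplacian (laplacian (at_theta theta phi n)) x
        + lambda1 / eps ^+ 2 * at_theta theta phi n x
        - lambda2 * laplacian (at_theta theta phi n) x &
      (u n.+1 - u n) / tau t n.+1 =
        V (xi n) / (2 * sqrtE1 n)
        * integral_on Omega
            (fun x => H x * ((phi n.+1 x - phi n x) / tau t n.+1))].

End VL_step.

(* Main.v *)
Require Import Defs.
From HB Require Import structures.
From mathcomp Require Import all_boot all_order all_algebra.
From mathcomp Require Import all_classical all_reals all_analysis.
From mathcomp Require Import measurable_realfun.
From mathcomp Require Import zify lra.
Import Order.TTheory GRing.Theory Num.Theory.
Import numFieldNormedType.Exports.
Import HBSimple.
Local Open Scope classical_set_scope.
Local Open Scope ring_scope.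

(* Testing the scheme against the constant function 1 kills the right-hand side,
   since the integral over the cell of the divergence of a periodic C^1 field
   vanishes: by Fubini one integrates d_i first along the i-th direction, where
   the fundamental theorem of calculus leaves a difference of two values that
   periodicity makes equal.  With S_n the integral of phi^n this gives
   A (S_{n+1} - S_n) + B (S_n - S_{n-1}) = 0 with A > 0, hence S_{n+1} = S_n by
   induction from S_1 = S_0. *)

(** * Joint measurability, product measures and Fubini's theorem *)

(* Replacing the second variable by a simple approximation of the identity
   splits f into finitely many measurable pieces; continuity in that variable
   recovers f as the pointwise limit. *)
Lemma measurable_fun_caratheodory d (T : measurableType d) (R : realType)
    (f : T * R -> R) :
  (forall y, measurable_fun setT (fun x => f (x, y))) ->
  (forall x, continuous (fun y => f (x, y))) ->
  measurable_fun setT f.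
Proof.
move=> mf cf.
have mE : measurable_fun [set: R] (@EFin R) by [].
have [g gE] : exists g : {sfun R >-> R}^nat,
    forall y, g n y @[n --> \oo] --> y.
  have [g gE] := approximation_sfun measurableT mE.
  by exists g => y; have /fine_cvgP[] := gE y I.
have ghf z : setT z -> f (z.1, g n z.2) @[n --> \oo] --> f z.
  by case: z => x y _; exact: cvg_comp (gE y) (cf x y).
apply: measurable_fun_cvg ghf.
move=> n _ Y mY; rewrite setTI.
rewrite (_ : _ @^-1` Y = \bigcup_(r in range (g n))
    (((fun x => f (x, r)) @^-1` Y) `*` (g n @^-1` [set r]))); last first.
  apply/seteqP; split=> [[x y] /= Yf|[x y] [r _] /= [Yf -> //]].
  by exists (g n y) => //; exists y.
have fg : finite_set (range (g n)) by exact: fimfunP.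
apply: fin_bigcup_measurable fg _ => r _; apply: measurableX => //.
by rewrite -[X in measurable X]setTI; exact: mf.
Qed.

Section product_sigma_finite.
Context {d1 d2} {T1 : measurableType d1} {T2 : measurableType d2} {R : realType}
  (m1 : {sigma_finite_measure set T1 -> \bar R})
  (m2 : {sigma_finite_measure set T2 -> \bar R}).

(** Products of two exhausting sequences of finite-measure sets exhaust the product space: both
    sequences increase, so the larger of two indices captures both coordinates. This makes Fubini
    available in dimension three, where the first factor is itself a product. *)
Lemma product_measure_sigma_finite :
  sigma_finite [set: T1 * T2] (m1 \x m2)%E.
Proof.
have /sigma_finiteP[F [FT ndF Foo]] := sigma_finiteT m1.
have /sigma_finiteP[G [GT ndG Goo]] := sigma_finiteT m2.
exists (fun n => F n `*` G n) => [|n].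
  apply/esym; rewrite -subTset => -[x y] _.
  have [n _ Fx] : (\bigcup_n F n) x by rewrite -FT.
  have [k _ Gy] : (\bigcup_n G n) y by rewrite -GT.
  exists (maxn n k) => //; split.
  - by apply: (subsetPset _ _ (ndF _ _ (leq_maxl n k))) Fx.
  - by apply: (subsetPset _ _ (ndG _ _ (leq_maxr n k))) Gy.
have [mF Fn] := Foo n; have [mG Gn] := Goo n.
split; first exact: measurableX.
by rewrite [ltLHS]product_measure1E// lte_mul_pinfty// ge0_fin_numE.
Qed.

(* The library's own instance cannot be inferred: product measures are already
   keyed to the instance for subprobabilities. *)
Definition product_sigma_finite_measure :
    {sigma_finite_measure set (T1 * T2)%type -> \bar R} :=
  HB.pack (product_measure1 m1 m2)
    (Measure_isSigmaFinite.Build _ _ _ (product_measure1 m1 m2)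
      product_measure_sigma_finite).

End product_sigma_finite.

Section fubini_zero.
Context {d1 d2} {T1 : measurableType d1} {T2 : measurableType d2} {R : realType}
  {m1 : {sigma_finite_measure set T1 -> \bar R}}
  {m2 : {sigma_finite_measure set T2 -> \bar R}}
  {A : set T1} {B : set T2} (mA : measurable A) (mB : measurable B)
  {f : T1 * T2 -> \bar R}
  (intf : (m1 \x m2)%E.-integrable (A `*` B) f).
Local Open Scope ereal_scope.

Let mAB : measurable (A `*` B). Proof. exact: measurableX. Qed.

(** Extending [f] by zero outside the rectangle allows Fubini on the whole space. The inner integral
    is then the one over [B] when [x] lies in [A], and the integral of zero otherwise. *)
Lemma integral_prod_eq0_2 : (forall x, A x -> \int[m2]_(y in B) f (x, y) = 0) ->
  \int[m1 \x m2]_(z in A `*` B) f z = 0.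
Proof.
move=> f0; rewrite integral_mkcond -integral12_prod_meas1; last first.
  exact: (integrable_mkcond f mAB).1 intf.
apply: integral0_eq => x _; rewrite /fubini_F.
have [Ax|nAx] := pselect (A x); last first.
  apply: integral0_eq => y _; rewrite patchE ifF//.
  by apply/negbTE/negP; rewrite inE/= => -[].
rewrite -[RHS](f0 x Ax) [RHS]integral_mkcond; apply: eq_integral => y _.
rewrite !patchE; congr (if _ then _ else _).
by apply/idP/idP; rewrite !inE/= => // -[].
Qed.

Lemma integral_prod_eq0_1 : (forall y, B y -> \int[m1]_(x in A) f (x, y) = 0) ->
  \int[m1 \x m2]_(z in A `*` B) f z = 0.
Proof.
move=> f0; rewrite integral_mkcond -integral21_prod_meas1; last first.
  exact: (integrable_mkcond f mAB).1 intf.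
apply: integral0_eq => y _; rewrite /fubini_G.
have [By|nBy] := pselect (B y); last first.
  apply: integral0_eq => x _; rewrite patchE ifF//.
  by apply/negbTE/negP; rewrite inE/= => -[].
rewrite -[RHS](f0 y By) [RHS]integral_mkcond; apply: eq_integral => x _.
rewrite !patchE; congr (if _ then _ else _).
by apply/idP/idP; rewrite !inE/= => // -[].
Qed.

End fubini_zero.

(** * Directional derivatives as derivatives along lines *)

Section directional.
Context {R : realType} {V : normedModType R}.
Implicit Types (f g : V -> R) (x v : V).

(** Both sides have literally the same difference quotient as a function of [h]. *)
Lemma is_derive_line f x v (y l : R) :
  is_derive (x + y *: v) v f l <-> is_derive y 1 (fun s => f (x + s *: v)) l.
Proof.
have E : (fun h : R => h^-1 *: ((f \o shift (x + y *: v)) (h *: v)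
     - f (x + y *: v))) =
  (fun h : R => h^-1 *: (((fun s => f (x + s *: v)) \o shift y) (h *: (1:R))
     - f (x + y *: v))).
  apply/funext => h; congr (_ *: (f _ - _)) => /=.
  by rewrite [_ *: 1]mulr1 scalerDl addrCA.
by split=> -[/= d1 d2]; apply: DeriveDef; move: d1 d2;
  rewrite /derivable /derive E.
Qed.

(** Restricting to the line through [x] in direction [v] reduces this to the one-variable chain rule
    at parameter 0, so a directional derivative of [f] suffices and no total derivative enters. *)
Lemma is_derive_comp_line (M : R -> R) f x v (m l : R) :
  is_derive (f x) 1 M m -> is_derive x v f l ->
  is_derive x v (M \o f) (m * l).
Proof.
rewrite -{2 3}[x]addr0 -(scale0r v) => dM /is_derive_line df.
by apply/is_derive_line/is_derive1_comp => //; rewrite scale0r addr0.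
Qed.

End directional.

(** * Calculus of functions with continuous partial derivatives *)

Section C1.
Context {R : realType} {d : nat}.
Implicit Types (f g : 'rV[R]_d -> R).

Lemma continuous_line {f} (x v : 'rV[R]_d) :
  continuous f -> continuous (fun y : R => f (x + y *: v)).
Proof.
move=> cf y; apply: (cvg_comp (fun y : R => x + y *: v) f _ (cf _)).
by apply: cvgD; [exact: cvg_cst|apply: cvgZr_tmp].
Qed.

Lemma classC_continuous {k f} : classC k f -> continuous f.
Proof. by case: k => [|k] //= -[]. Qed.

Lemma classCS_C1 {k f} : classC k.+1 f -> classC 1 f.
Proof. by case=> cf df pf; split=> // i; exact: classC_continuous (pf i). Qed.

Lemma is_derive_partial {f} i x : classC 1 f ->
  is_derive x (delta_mx 0 i) f (partial i f x).
Proof. by case=> _ df _; apply: DeriveDef. Qed.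

(** The derivative rules for sums, products and composites give explicit formulas [df], whose
    continuity is easier to check than that of [partial i f] itself. *)
Lemma classC1_is_derive {f} (df : 'I_d -> 'rV[R]_d -> R) :
  continuous f -> (forall i, continuous (df i)) ->
  (forall i x, is_derive x (delta_mx 0 i) f (df i x)) -> classC 1 f.
Proof.
move=> cf cdf fdf; split=> // i /=.
rewrite (_ : partial i f = df i)//; apply/funext => x.
by have [] := fdf i x.
Qed.

Lemma classC1_partial {f} i : classC 1 f -> continuous (partial i f).
Proof. by case=> _ _; exact. Qed.

Lemma continuous_lincomb (c e : R) {f g} : continuous f -> continuous g ->
  continuous (fun x => c * f x + e * g x).
Proof.
by move=> cf cg x; exact: cvgD (cvgMl_tmp (cf x)) (cvgMl_tmp (cg x)).
Qed.

Lemma classC1_lincomb (c e : R) {f g} : classC 1 f -> classC 1 g ->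
  classC 1 (fun x => c * f x + e * g x).
Proof.
move=> Cf Cg.
apply: (classC1_is_derive (fun i x => c * partial i f x + e * partial i g x)).
- exact: continuous_lincomb (classC_continuous Cf) (classC_continuous Cg).
- by move=> i; apply: continuous_lincomb; exact: classC1_partial.
move=> i x; have := is_derive_partial i x Cf; have := is_derive_partial i x Cg.
move=> dg df; exact: is_deriveD.
Qed.

Lemma classC1_mul {f g} : classC 1 f -> classC 1 g ->
  classC 1 (fun x => f x * g x).
Proof.
move=> Cf Cg.
apply: (classC1_is_derive
  (fun i x => f x * partial i g x + g x * partial i f x)).
- by move=> x; exact: cvgM (classC_continuous Cf x) (classC_continuous Cg x).
- move=> i x.
  exact: cvgD (cvgM (classC_continuous Cf x) (classC1_partial i Cg x))
              (cvgM (classC_continuous Cg x) (classC1_partial i Cf x)).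
move=> i x; have := is_derive_partial i x Cf; have := is_derive_partial i x Cg.
move=> dg df; exact: is_deriveM.
Qed.

Lemma classC1_comp {M : R -> R} {f} : classC_real 1 M -> classC 1 f ->
  classC 1 (fun x => M (f x)).
Proof.
move=> [dM cM] Cf.
have cf := classC_continuous Cf.
have DM y : derivable M y 1 by exact: dM 0%N y _.
have cM0 : continuous M.
  by move=> y; apply: differentiable_continuous; apply/derivable1_diffP.
apply: (classC1_is_derive (fun i x => M^`()%classic (f x) * partial i f x)).
- by move=> x; exact: cvg_comp (cf x) (cM0 (f x)).
- move=> i x.
  exact: cvgM (cvg_comp f M^`()%classic (cf x) (cM (f x)))
    (classC1_partial i Cf x).
move=> i x; apply: is_derive_comp_line; last exact: is_derive_partial.
by apply: DeriveDef => //; rewrite derive1E.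
Qed.

(** * Periodicity and integration along one coordinate direction *)

Variables (a b : 'rV[R]_d).

(** A shift by one period leaves every difference quotient unchanged, hence also its limit. *)
Lemma cell_periodic_partial f i :
  cell_periodic a b f -> cell_periodic a b (partial i f).
Proof.
move=> pf j x; rewrite /partial /derive; set w := _ *: delta_mx 0 j.
rewrite (_ : (fun h => h^-1 *: ((f \o shift (x + w)) (h *: delta_mx 0 i)
     - f (x + w)))
  = (fun h => h^-1 *: ((f \o shift x) (h *: delta_mx 0 i) - f x)))//.
by apply/funext => h /=; rewrite addrA !pf.
Qed.

Lemma integral_line_partial0 f (i : 'I_d) (x : 'rV[R]_d) :
  (forall j, a 0 j < b 0 j) ->
  classC 1 f -> cell_periodic a b f ->
  (\int[@lebesgue_measure R]_(y in `](a 0 i)%R, (b 0 i)%R[)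
     (partial i f (x + y *: delta_mx 0 i)%R)%:E = 0)%E.
Proof.
move=> ab Cf pf; set e := delta_mx 0 i.
have cp : continuous (fun y : R => partial i f (x + y *: e)).
  by apply: continuous_line; exact: classC1_partial.
have cf := continuous_line x e (classC_continuous Cf).
have dF (y : R) :
    is_derive y 1 (fun y : R => f (x + y *: e)) (partial i f (x + y *: e)).
  exact: (is_derive_line f x e y _).1 (is_derive_partial i _ Cf).
(* The cell is open while the fundamental theorem of calculus is stated on a closed interval; adding
   the two endpoints does not change the integral. *)
rewrite integral_itv_obnd_cbnd; last first.
  apply/measurable_EFinP/measurable_funTS; exact: continuous_measurable_fun.
rewrite integral_itv_bndo_bndc; last first.
  apply/measurable_EFinP/measurable_funTS; exact: continuous_measurable_fun.
rewrite (continuous_FTC2 (F := fun y : R => f (x + y *: e)))//.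
(* The upper endpoint is the lower one moved by one full period along [e], so the two boundary
   values cancel. *)
- rewrite (_ : x + b 0 i *: e = x + a 0 i *: e + (b 0 i - a 0 i) *: e).
    by rewrite pf subee.
  by rewrite scalerBl addrACA subrr addr0.
- exact: continuous_subspaceT.
- split=> [y _||]; first exact: ex_derive.
    by apply: cvg_at_right_filter; exact: cf.
  by apply: cvg_at_left_filter; exact: cf.
- by move=> y _; rewrite derive1E; apply: derive_val.
Qed.

End C1.

(** * Coordinates and integrability on the cell in dimensions two and three *)

Section box.
Context {R : realType}.
Notation leb := (@lebesgue_measure R).
Notation leb2 := (leb \x leb)%E.
Notation leb3 := (leb2 \x leb)%E.

Lemma cell_bounded d (a b : 'rV[R]_d) (f : 'rV[R]_d -> R) : continuous f ->
  exists K, forall x, cell a b x -> `|f x| <= K.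
Proof.
move=> cf.
pose A (i : 'I_d) := `[a 0 i, b 0 i]%classic.
have cA : compact [set v : 'rV[R]_d | forall i, A i (v ord0 i)].
  by apply: rV_compact => i; exact: segment_compact.
have [K [_ fK]] := compact_bounded
  (continuous_compact (continuous_subspaceT cf) cA).
(* Boundedness on the compact closed box provides a bound by every real strictly above [K], whence
   [K + 1]. *)
exists (K + 1) => x abx; apply: (fK (K + 1)); first by rewrite ltrDl.
by exists x => // i; rewrite /A/= in_itv/=;
  have /andP[/ltW -> /ltW ->] := abx i.
Qed.

(** This and its variants exhibit a slice of the coordinate map as a line [x + y *: v], the form
    required by [continuous_line] and [integral_line_partial0]. They hold for every [d], since
    coordinates past the end of the list take the default value 0 on both sides. *)
Lemma vec2_line1 d (x y : R) :
  vec2 d (x, y) = vec2 d (x, 0) + y *: vec2 d (0, 1).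
Proof.
apply/rowP => i; rewrite !mxE.
by case: i => -[|[|[|i]]] /= hi;
  rewrite ?mulr0 ?mulr1 ?addr0 ?add0r// nth_nil.
Qed.

Lemma vec2_line0 d (x y : R) :
  vec2 d (x, y) = vec2 d (0, y) + x *: vec2 d (1, 0).
Proof.
apply/rowP => i; rewrite !mxE.
by case: i => -[|[|[|i]]] /= hi;
  rewrite ?mulr0 ?mulr1 ?addr0 ?add0r// nth_nil.
Qed.

Lemma vec3_line2 d (x y z : R) :
  vec3 d (x, y, z) = vec3 d (x, y, 0) + z *: vec3 d (0, 0, 1).
Proof.
apply/rowP => i; rewrite !mxE.
by case: i => -[|[|[|[|i]]]] /= hi;
  rewrite ?mulr0 ?mulr1 ?addr0 ?add0r// nth_nil.
Qed.

Lemma vec3_line1 d (x y z : R) :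
  vec3 d (x, y, z) = vec3 d (x, 0, z) + y *: vec3 d (0, 1, 0).
Proof.
apply/rowP => i; rewrite !mxE.
by case: i => -[|[|[|[|i]]]] /= hi;
  rewrite ?mulr0 ?mulr1 ?addr0 ?add0r// nth_nil.
Qed.

Lemma vec3_line0 d (x y z : R) :
  vec3 d (x, y, z) = vec3 d (0, y, z) + x *: vec3 d (1, 0, 0).
Proof.
apply/rowP => i; rewrite !mxE.
by case: i => -[|[|[|[|i]]]] /= hi;
  rewrite ?mulr0 ?mulr1 ?addr0 ?add0r// nth_nil.
Qed.

Lemma ord2P (i : 'I_2) : i = 0 \/ i = 1.
Proof. by case: i => -[|[|//]] hi; [left|right]; exact: val_inj. Qed.

Lemma ord3P (i : 'I_3) : [\/ i = 0, i = 1 | i = 2].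
Proof.
by case: i => -[|[|[|//]]] hi; [exact/Or31/val_inj|exact/Or32/val_inj|
  exact/Or33/val_inj].
Qed.

Lemma vec2_delta0 : vec2 2 (1, 0) = delta_mx 0 0 :> 'rV[R]_2.
Proof. by apply/rowP => i; rewrite !mxE; have [->|->] := ord2P i. Qed.

Lemma vec2_delta1 : vec2 2 (0, 1) = delta_mx 0 1 :> 'rV[R]_2.
Proof. by apply/rowP => i; rewrite !mxE; have [->|->] := ord2P i. Qed.

Lemma vec3_delta0 : vec3 3 (1, 0, 0) = delta_mx 0 0 :> 'rV[R]_3.
Proof. by apply/rowP => i; rewrite !mxE; have [->|->|->] := ord3P i. Qed.

Lemma vec3_delta1 : vec3 3 (0, 1, 0) = delta_mx 0 1 :> 'rV[R]_3.
Proof. by apply/rowP => i; rewrite !mxE; have [->|->|->] := ord3P i. Qed.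

Lemma vec3_delta2 : vec3 3 (0, 0, 1) = delta_mx 0 2 :> 'rV[R]_3.
Proof. by apply/rowP => i; rewrite !mxE; have [->|->|->] := ord3P i. Qed.

(** Along each coordinate line the function is continuous, which is all that
    [measurable_fun_caratheodory] asks; measurability of [vec2] as a map into row vectors is thus
    bypassed. *)
Lemma measurable_fun_vec2 d (f : 'rV[R]_d -> R) : continuous f ->
  measurable_fun setT (fun p : R * R => f (vec2 d p)).
Proof.
move=> cf; apply: measurable_fun_caratheodory => [y|x].
  apply: continuous_measurable_fun.
  rewrite (_ : (fun _ => _) =
      (fun x => f (vec2 d (0, y) + x *: vec2 d (1, 0)))).
    exact: continuous_line.
  by apply/funext => x; rewrite vec2_line0.
rewrite (_ : (fun _ => _) =
      (fun y => f (vec2 d (x, 0) + y *: vec2 d (0, 1)))).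
  exact: continuous_line.
by apply/funext => y; rewrite vec2_line1.
Qed.

Lemma measurable_fun_vec3 d (f : 'rV[R]_d -> R) : continuous f ->
  measurable_fun setT (fun p : R * R * R => f (vec3 d p)).
Proof.
(* The criterion is used twice: first with [z] as the continuous variable, then, for fixed [z], with
   [y], which leaves a continuous function of [x] alone. *)
move=> cf; apply: measurable_fun_caratheodory => [z|[x y]]; last first.
  rewrite (_ : (fun _ => _) =
      (fun z => f (vec3 d (x, y, 0) + z *: vec3 d (0, 0, 1)))).
    exact: continuous_line.
  by apply/funext => z; rewrite vec3_line2.
apply: measurable_fun_caratheodory => [y|x].
  apply: continuous_measurable_fun.
  rewrite (_ : (fun _ => _) =
      (fun x => f (vec3 d (0, y, z) + x *: vec3 d (1, 0, 0)))).
    exact: continuous_line.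
  by apply/funext => x; rewrite vec3_line0.
rewrite (_ : (fun _ => _) =
      (fun y => f (vec3 d (x, 0, z) + y *: vec3 d (0, 1, 0)))).
  exact: continuous_line.
by apply/funext => y; rewrite vec3_line1.
Qed.

Section side.
Context {d : nat} (a b : 'rV[R]_d).

Definition side (i : 'I_d) : set (measurableTypeR R) :=
  `](a 0 i), (b 0 i)[%classic.

Lemma measurable_side i : measurable (side i).
Proof. exact: measurable_itv. Qed.

Lemma lebesgue_side_lty i : (leb (side i) < +oo)%E.
Proof.
by rewrite /side lebesgue_measure_itv/=; case: ifP => _;
  rewrite ?EFinN -?EFinD ltry.
Qed.

End side.

(** In product coordinates the cell is a rectangle, the shape on which the Fubini lemmas operate. *)
Lemma vec2_cell (a b : 'rV[R]_2) :
  vec2 2 @^-1` cell a b = side a b 0 `*` side a b 1.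
Proof.
apply/seteqP; split => [[x y] /= abx|[x y] [/= xab yab] i].
  by split; rewrite /side/= in_itv/=;
    [have := abx 0|have := abx 1]; rewrite mxE.
move: xab yab; rewrite /side/= !in_itv/= mxE.
by have [->|->] := ord2P i.
Qed.

Lemma vec3_cell (a b : 'rV[R]_3) :
  vec3 3 @^-1` cell a b = side a b 0 `*` side a b 1 `*` side a b 2.
Proof.
apply/seteqP; split => [[[x y] z] /= abx|[[x y] z] [[/= xab yab] zab] i].
  split=> /=; first split; rewrite /side/= in_itv/=;
   [have := abx 0|have := abx 1|have := abx 2]; by rewrite mxE.
move: xab yab zab; rewrite /side/= !in_itv/= mxE.
by have [->|->|->] := ord3P i.
Qed.

Lemma integrable_bounded d (T : measurableType d)
    (m : {measure set T -> \bar R}) (D : set T) (f : T -> R) (K : R) :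
  measurable D -> (m D < +oo)%E ->
  measurable_fun setT f -> (forall x, D x -> `|f x| <= K) ->
  m.-integrable D (EFin \o f).
Proof.
move=> mD Doo mf fK; apply: measurable_bounded_integrable => //.
  exact: measurable_funTS.
exists K; split; first exact: num_real.
by move=> M /ltW KM x Dx; exact: le_trans (fK x Dx) KM.
Qed.

Lemma measure_sides2_lty d (a b : 'rV[R]_d) i j :
  (leb2 (side a b i `*` side a b j) < +oo)%E.
Proof.
rewrite [ltLHS]product_measure1E; [|exact: measurable_side..].
by rewrite lte_mul_pinfty// ?ge0_fin_numE ?lebesgue_side_lty.
Qed.

Lemma integrable_vec2_cell (a b : 'rV[R]_2) (f : 'rV[R]_2 -> R) :
  continuous f ->
  leb2.-integrable (vec2 2 @^-1` cell a b) (fun p => (f (vec2 2 p))%:E).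
Proof.
move=> cf; have [K fK] := cell_bounded _ a b _ cf.
apply: (@integrable_bounded _ _ leb2 _ (fun p => f (vec2 2 p)) K).
- by rewrite vec2_cell; apply: measurableX; exact: measurable_side.
- by rewrite vec2_cell; exact: measure_sides2_lty.
- exact: measurable_fun_vec2.
- by move=> p abp; exact: fK.
Qed.

Lemma integrable_vec3_cell (a b : 'rV[R]_3) (f : 'rV[R]_3 -> R) :
  continuous f ->
  leb3.-integrable (vec3 3 @^-1` cell a b) (fun p => (f (vec3 3 p))%:E).
Proof.
move=> cf; have [K fK] := cell_bounded _ a b _ cf.
have mS : measurable (side a b 0 `*` side a b 1).
  by apply: measurableX; exact: measurable_side.
apply: (@integrable_bounded _ _ leb3 _ (fun p => f (vec3 3 p)) K).
- by rewrite vec3_cell; apply: measurableX => //; exact: measurable_side.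
- rewrite vec3_cell [ltLHS]product_measure1E//; last exact: measurable_side.
  by rewrite lte_mul_pinfty// ?ge0_fin_numE ?lebesgue_side_lty//
    measure_sides2_lty.
- exact: measurable_fun_vec3.
- by move=> p abp; exact: fK.
Qed.

Lemma Rintegral_lincomb d (T : measurableType d) (m : {measure set T -> \bar R})
    (D : set T) (c e : R) (f g : T -> R) : measurable D ->
  m.-integrable D (EFin \o f) -> m.-integrable D (EFin \o g) ->
  \int[m]_(x in D) (c * f x + e * g x) =
  c * \int[m]_(x in D) f x + e * \int[m]_(x in D) g x.
Proof.
move=> mD intf intg; rewrite RintegralD//; last 2 first.
- exact: (integrableZl mD c intf).
- exact: (integrableZl mD e intg).
by rewrite !RintegralZl.
Qed.

(** Continuity of [f] and [g] gives integrability on the bounded cell in either dimension, so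
    linearity of the integral applies. *)
Lemma integral_on_lincomb d (a b : 'rV[R]_d) (c e : R) (f g : 'rV[R]_d -> R) :
  d = 2%N \/ d = 3%N -> continuous f -> continuous g ->
  integral_on (cell a b) (fun x => c * f x + e * g x) =
  c * integral_on (cell a b) f + e * integral_on (cell a b) g.
Proof.
move=> hd cf cg; case: hd => ?; subst d; rewrite /integral_on/=.
- apply: Rintegral_lincomb; [|exact: integrable_vec2_cell..].
  by rewrite vec2_cell; apply: measurableX; exact: measurable_side.
- apply: Rintegral_lincomb; [|exact: integrable_vec3_cell..].
  rewrite vec3_cell; apply: measurableX; last exact: measurable_side.
  by apply: measurableX; exact: measurable_side.
Qed.

(** * Vanishing integrals of partial derivatives and divergences *)

Lemma integral_vec2_partial0 (a b : 'rV[R]_2) (f : 'rV[R]_2 -> R) i :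
  (forall j, a 0 j < b 0 j) -> classC 1 f -> cell_periodic a b f ->
  (\int[leb2]_(p in vec2 2 @^-1` cell a b) (partial i f (vec2 2 p))%:E = 0)%E.
Proof.
move=> ab Cf pf.
have := integrable_vec2_cell a b _ (classC1_partial i Cf).
rewrite vec2_cell => intf.
have mside j : measurable (side a b j) by exact: measurable_side.
have [i0|i1] := ord2P i; subst i.
- apply: (integral_prod_eq0_1 (mside 0) (mside 1) intf) => y _.
  rewrite -[RHS](integral_line_partial0 a b f 0 (vec2 2 (0, y)) ab Cf pf).
  by apply: eq_integral => x _; rewrite vec2_line0 vec2_delta0.
- apply: (integral_prod_eq0_2 (mside 0) (mside 1) intf) => x _.
  rewrite -[RHS](integral_line_partial0 a b f 1 (vec2 2 (x, 0)) ab Cf pf).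
  by apply: eq_integral => y _; rewrite vec2_line1 vec2_delta1.
Qed.

(** For directions 0 and 1, Fubini first splits off the last variable, and a second, two-dimensional
    Fubini then reaches the line integral. For direction 2 a single Fubini suffices. *)
Lemma integral_vec3_partial0 (a b : 'rV[R]_3) (f : 'rV[R]_3 -> R) i :
  (forall j, a 0 j < b 0 j) -> classC 1 f -> cell_periodic a b f ->
  (\int[leb3]_(p in vec3 3 @^-1` cell a b) (partial i f (vec3 3 p))%:E = 0)%E.
Proof.
move=> ab Cf pf.
have cpf := classC1_partial i Cf.
have := integrable_vec3_cell a b _ cpf.
rewrite vec3_cell => intf.
have mside j : measurable (side a b j) by exact: measurable_side.
have mS : measurable (side a b 0 `*` side a b 1) by exact: measurableX.
(* The second Fubini needs integrability of each slice, not merely of almost every one; a uniform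
   bound on the cell supplies it. *)
have intz z : side a b 2 z -> leb2.-integrable (side a b 0 `*` side a b 1)
    (fun p => (partial i f (vec3 3 (p, z)))%:E).
  move=> zab; have [K fK] := cell_bounded _ a b _ cpf.
  apply: (@integrable_bounded _ _ leb2 _
    (fun p => partial i f (vec3 3 (p, z))) K).
  - exact: mS.
  - exact: measure_sides2_lty.
  - exact: measurableT_comp (measurable_fun_vec3 _ _ cpf) (pair2_measurable z).
  - move=> p abp; apply: fK.
    rewrite -[cell a b _]/((vec3 3 @^-1` cell a b) (p, z)).
    by rewrite vec3_cell.
pose m12 := product_sigma_finite_measure leb leb.
have [i0|i1|i2] := ord3P i; subst i.
- apply: (integral_prod_eq0_1 (m1 := m12) mS (mside 2) intf) => z zab.
  apply: (integral_prod_eq0_1 (mside 0) (mside 1) (intz z zab)) => y _.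
  rewrite -[RHS](integral_line_partial0 a b f 0 (vec3 3 (0, y, z)) ab Cf pf).
  by apply: eq_integral => x _; rewrite vec3_line0 vec3_delta0.
- apply: (integral_prod_eq0_1 (m1 := m12) mS (mside 2) intf) => z zab.
  apply: (integral_prod_eq0_2 (mside 0) (mside 1) (intz z zab)) => x _.
  rewrite -[RHS](integral_line_partial0 a b f 1 (vec3 3 (x, 0, z)) ab Cf pf).
  by apply: eq_integral => y _; rewrite vec3_line1 vec3_delta1.
- apply: (integral_prod_eq0_2 (m1 := m12) mS (mside 2) intf) => -[x y] _.
  rewrite -[RHS](integral_line_partial0 a b f 2 (vec3 3 (x, y, 0)) ab Cf pf).
  by apply: eq_integral => z _; rewrite vec3_line2 vec3_delta2.
Qed.

Lemma integral_on_partial0 d (a b : 'rV[R]_d) (f : 'rV[R]_d -> R) i :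
  d = 2%N \/ d = 3%N -> (forall j, a 0 j < b 0 j) ->
  classC 1 f -> cell_periodic a b f ->
  integral_on (cell a b) (partial i f) = 0.
Proof.
move=> hd ab Cf pf; case: hd => ?; subst d; rewrite /integral_on/= /Rintegral.
- by rewrite integral_vec2_partial0.
- by rewrite integral_vec3_partial0.
Qed.

Lemma integral_on_divergence0 d (a b : 'rV[R]_d) (w : 'rV[R]_d -> 'rV[R]_d) :
  d = 2%N \/ d = 3%N -> (forall j, a 0 j < b 0 j) ->
  (forall i, classC 1 (fun x => w x 0 i) /\
             cell_periodic a b (fun x => w x 0 i)) ->
  integral_on (cell a b) (divergence w) = 0.
Proof.
move=> hd ab Cw; pose F i := partial i (fun x => w x 0 i).
have cF i : continuous (F i) by exact: classC1_partial (Cw i).1.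
(* The induction over the list of directions carries continuity along with the vanishing integral,
   because splitting off one term by [integral_on_lincomb] needs the remaining sum to be
   continuous. *)
suff [] : continuous (fun x => \sum_(i <- index_enum 'I_d) F i x) /\
  integral_on (cell a b) (fun x => \sum_(i <- index_enum 'I_d) F i x) = 0 by [].
elim: (index_enum _) => [|i s [cs is0]].
  have -> : (fun x => \sum_(i <- [::]) F i x) = (fun=> 0 : R).
    by apply/funext => x; rewrite big_nil.
  have c0 : continuous (fun _ : 'rV[R]_d => 0 : R).
    exact: cst_continuous.
  (* The empty sum is handled by linearity with both coefficients 0, which covers both dimensions at
     once. *)
  split=> //; have := integral_on_lincomb d a b 0 0 _ _ hd c0 c0.
  have -> : (fun _ : 'rV[R]_d => 0 * 0 + 0 * 0 : R) = (fun=> 0).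
    by rewrite !mul0r addr0.
  by rewrite !mul0r addr0.
have E : (fun x => \sum_(j <- i :: s) F j x) =
    (fun x => 1 * F i x + 1 * \sum_(j <- s) F j x).
  by apply/funext => x; rewrite big_cons !mul1r.
rewrite E; split; first exact: continuous_lincomb.
rewrite integral_on_lincomb// is0 integral_on_partial0 ?mulr0 ?addr0//.
- exact: (Cw i).1.
- exact: (Cw i).2.
Qed.

End box.

(** * The time discretization and the conservation of mass *)

Lemma cell_periodic_lincomb {R : realType} {d} {a b : 'rV[R]_d} (c e : R)
    {f g : 'rV[R]_d -> R} : cell_periodic a b f -> cell_periodic a b g ->
  cell_periodic a b (fun x => c * f x + e * g x).
Proof. by move=> pf pg i x; rewrite pf pg. Qed.

Lemma extrapolatedE {R : realType} {X : Type} (t : nat -> R) (theta : R)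
    (w : nat -> X -> R) n : extrapolated t theta w n =
  (fun x => (1 + theta * step_ratio t n.+1) * w n x +
            - (theta * step_ratio t n.+1) * w n.-1 x).
Proof. by apply/funext => x; rewrite /extrapolated mulNr. Qed.

(* The coefficients 1 and -1 are kept so that [integral_on_lincomb] applies. *)
Lemma DtauE {R : realType} {X : Type} (t : nat -> R) (theta : R)
    (w : nat -> X -> R) n : exists C, Dtau t theta w n =
  (fun x =>
    (1 + 2 * theta * step_ratio t n.+1) / (tau t n.+1 * (1 + step_ratio t n.+1))
      * (1 * w n.+1 x + -1 * w n x)
    + C * (1 * w n x + -1 * w n.-1 x)).
Proof.
exists ((1 - 2 * theta) * step_ratio t n.+1 ^+ 2 /
  (tau t n.+1 * (1 + step_ratio t n.+1))).
by apply/funext => x; rewrite !mul1r !mulN1r.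
Qed.

Theorem theorem4p2 (R : realType) (d : nat) (hd : d = 2%N \/ d = 3%N)
    (* periodic cell *)
    (a b : 'rV[R]_d) (hab : forall i, a 0 i < b 0 i)
    (* physical parameters *)
    (alpha eps beta lambda1 lambda2 C0 theta : R)
    (halpha : 0 <= alpha) (heps : 0 < eps) (hbeta : 0 < beta)
    (hlambda1 : 0 < lambda1) (hlambda2 : 0 < lambda2) (hC0 : 0 < C0)
    (htheta : 1 / 2 <= theta <= 1)
    (* mobility *)
    (M : R -> R) (M0 : R) (hM0 : 0 < M0) (hM : forall s, M0 <= M s)
    (hMreg : classC_real 1 M)
    (* auxiliary function V *)
    (V : R -> R) (hVreg : classC_real 2 V) (hVpos : forall s, 0 < V s)
    (hV1 : V 1 = 1) (hVlim : (V s - 1) / (1 - s) @[s --> (1 : R)^'] --> (1 : R))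
    (* time mesh *)
    (N : nat) (T : R) (t : nat -> R) (hN : (0 < N)%N) (ht : time_mesh t N T)
    (* discrete solution; mu n is mu^{n+theta}, H n is H^{*,n+theta} *)
    (phi : nat -> 'rV[R]_d -> R) (u : nat -> R) (mu H : nat -> 'rV[R]_d -> R)
    (hphi : forall n, (n <= N)%N ->
       classC 4 (phi n) /\ cell_periodic a b (phi n))
    (hmu : forall n, (1 <= n < N)%N ->
       classC 2 (mu n) /\ cell_periodic a b (mu n))
    (hH : forall n, (1 <= n < N)%N ->
       classC 0 (H n) /\ cell_periodic a b (H n))
    (hE1 : forall n, (n <= N)%N ->
       0 < E1 (cell a b) alpha eps lambda1 lambda2 C0 (phi n))
    (hscheme : forall n, (1 <= n < N)%N ->
       VL_step (cell a b) alpha eps beta lambda1 lambda2 C0 theta M V t phi u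
         n (mu n) (H n))
    (hstart : integral_on (cell a b) (phi 1%N)
              = integral_on (cell a b) (phi 0%N)) :
  forall n, (n < N)%N ->
    integral_on (cell a b) (phi n.+1) = integral_on (cell a b) (phi n) /\
    integral_on (cell a b) (phi n) = integral_on (cell a b) (phi 0%N).
Proof.
suff step n : (n < N)%N ->
    integral_on (cell a b) (phi n.+1) = integral_on (cell a b) (phi n).
  move=> n nN; split; first exact: step.
  elim: n nN => // n IH nN.
  by rewrite step ?IH// ltnW.
(* The base case is [hstart], since the scheme only acts from level 1 on. The inductive step applies
   it at level [n.+1], which involves [phi] at [n], [n.+1] and [n.+2]. *)
elim: n => // n IH nN.
have nN' : (1 <= n.+1 < N)%N by [].
have [_ schemephi _ _] := hscheme _ nN'.
have Cphi k : (k <= N)%N -> classC 1 (phi k).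
  by move=> /hphi[] /classCS_C1.
have pphi k : (k <= N)%N -> cell_periodic a b (phi k) by move=> /hphi[].
have [Cmu pmu] := hmu _ nN'.
have n0N : (n <= N)%N by lia.
have n1N : (n.+1 <= N)%N by lia.
have tau_gt0 k : (0 < k <= N)%N -> 0 < tau t k.
  case: k => // k /= kN; rewrite /tau subr_gt0.
  by have [_ _] := ht; exact.
have r_gt0 : 0 < step_ratio t n.+2.
  by rewrite divr_gt0// tau_gt0//; lia.
have div0 : integral_on (cell a b) (Dtau t theta phi n.+1) = 0.
  rewrite (funext schemephi); apply: integral_on_divergence0 => // i.
  (* Each flux component is the mobility at the extrapolated [phi] times a partial derivative of
     [mu]; it is of class C^1 because [mu] is C^2 and both [M] and [phi] are at least C^1. *)
  rewrite (_ : (fun x => _) = (fun x => M (extrapolated t theta phi n.+1 x) *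
      partial i (mu n.+1) x)); last by apply/funext => x; rewrite !mxE.
  rewrite extrapolatedE; split.
    apply: classC1_mul; last by case: Cmu => _ _; exact.
    by apply: classC1_comp => //; apply: classC1_lincomb; exact: Cphi.
  have pext := cell_periodic_lincomb (1 + theta * step_ratio t n.+2)
    (- (theta * step_ratio t n.+2)) (pphi _ n1N) (pphi _ n0N).
  move=> j x; rewrite (cell_periodic_partial _ _ _ i pmu).
  by congr (M _ * _); exact: pext.
have [C DE] := DtauE t theta phi n.+1.
move: div0; rewrite DE.
have cphi k : (k <= N)%N -> continuous (phi k).
  by move=> /Cphi; exact: classC_continuous.
rewrite !integral_on_lincomb//;
  try (exact: cphi || (apply: continuous_lincomb; exact: cphi)).
(* The induction hypothesis annihilates the older difference, so nothing about the value or sign of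
   [C] matters. *)
rewrite (IH (ltnW nN)) !mul1r !mulN1r subrr mulr0 addr0 => /eqP.
rewrite mulf_eq0 subr_eq0 => /orP[|/eqP//].
(* The leading coefficient is nonzero: time steps and step ratios are positive, and [theta] is at
   least 1/2, hence positive. *)
rewrite gt_eqF// divr_gt0// ?mulr_gt0 ?tau_gt0 ?addr_gt0//.
have /andP[th _] := htheta.
by rewrite mulr_gt0// mulr_gt0//; lra.
Qed.
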